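(* Let $n\ge1$ and write $\langle m\rangle=\prod_{j=1}^m(x-j)$ for $m\ge0$. For $1\le i\le n$, the characteristic polynomial of $\mathrm{M}\Pi^A_{n,i}$ is $$\mathrm{M}\chi^A_{n,i}(x)=\frac{x-2i}{x-i}\,\frac{\langle i\rangle\langle 2n-1\rangle}{\langle n+i\rangle},$$ and its constant term is $(-1)^{n-1}\,2\,\frac{i!(2n-1)!}{(n+i)!}$. For $0\le i\le n$, the characteristic polynomial of $\mathrm{M}\Pi^{A'}_{n,i}$ is $$\mathrm{M}\chi^{A'}_{n,i}(x)=\frac{\langle i\rangle\langle 2n-i-1\rangle}{\langle n\rangle},$$ and its constant term is $(-1)^{n-1}\frac{i!(2n-i-1)!}{n!}$.
   Context: Write $[n]=\{1,\dots,n\}$. A multi-pointed partition of $[n]$ is a partition of $[n]$ into non-empty blocks together with the choice of a non-empty subset of each block, called the pointed subset of this block. The poset $\mathrm{M}\Pi^A_n$ is the set of multi-pointed partitions of $[n]$ with the partial order generated by the following relations: $\pi<\nu$ if $\nu$ is obtained from $\pi$ by gathering two blocks into one, the pointed subset of the new block being either one of the two pointed subsets of the two small blocks or their union (other blocks and their pointed subsets unchanged). It has a minimal element $\hat 0$ (all blocks singletons) and is pure, the rank of a multi-pointed partition being $n$ minus its number of blocks. For $1\le i\le n$, $\mathrm{M}\Pi^A_{n,i}$ is the subposet (with the induced order) of multi-pointed partitions of $[n]$ in which all elements of $[i]$ are pointed. For $1\le i\le n$, $\mathrm{M}\Pi^{A'}_{n,i}$ is the interval of $\mathrm{M}\Pi^A_n$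 between $\hat 0$ and a multi-pointed partition with a single block and $i$ pointed elements (up to isomorphism it does not depend on the choice of the pointed elements). By convention $\mathrm{M}\Pi^{A'}_{n,0}=\mathrm{M}\Pi^A_n$. For a pure finite poset $\Pi$ with minimal element $\hat 0$, rank function $\operatorname{rk}$ and maximal elements of rank $r$, the characteristic polynomial is $\chi(x)=\sum_{a\in\Pi}\mu(a)\,x^{r-\operatorname{rk}(a)}$, where $\mu(a)=\mu(\hat 0,a)$ is the Möbius function of $\Pi$. *)

(* Defs.v *)
From HB Require Import structures.
From mathcomp Require Import all_boot all_order all_algebra.
Set Implicit Arguments.
Unset Strict Implicit.
Unset Printing Implicit Defensive.

Import Order.TTheory GRing.Theory Num.Theory.
Local Open Scope ring_scope.

(******************************************************************************)
(* Finite posets. A subposet (with the induced order) of T : finPOrderType is *)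
(* given by the set A : {set T} of its elements.                              *)
(******************************************************************************)

(* The first argument k bounds the depth of the recursion; see mobiusE.       *)
Fixpoint mobius_rec (d : Order.disp_t) (T : finPOrderType d) (A : {set T})
    (k : nat) (x y : T) : int :=
  if k is k'.+1 then
    if x == y then 1
    else - \sum_(z in A | (x <= z)%O && (z < y)%O) mobius_rec A k' x z
  else 0.

Definition mobius (d : Order.disp_t) (T : finPOrderType d) (A : {set T})
    (x y : T) : int :=
  mobius_rec A #|T| x y.

Lemma mobius_rec_stable (d : Order.disp_t) (T : finPOrderType d) (A : {set T})
    (x y : T) (k : nat) :
  (#|[set z : T | (z < y)%O]| < k)%N ->
  mobius_rec A k x y = mobius_rec A #|[set z : T | (z < y)%O]|.+1 x y.
Proof.
have [m] := ubnP k; elim: m => // m IHm in k y *.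
case: k => // k; rewrite !ltnS => le_km le_yk /=.
case: eqP => // _; congr (- _); apply: eq_bigr => z /and3P[_ _ lt_zy].
have lt_card : (#|[set t : T | (t < z)%O]| < #|[set t : T | (t < y)%O]|)%N.
  apply/proper_card/properP; split; last by exists z; rewrite inE ?ltxx.
  by apply/subsetP => t; rewrite !inE => /lt_trans; apply.
rewrite (IHm k) //; last exact: leq_trans lt_card le_yk.
by rewrite [RHS]IHm //; apply: leq_ltn_trans le_yk le_km.
Qed.

Lemma mobiusE (d : Order.disp_t) (T : finPOrderType d) (A : {set T})
    (x y : T) :
  mobius A x y =
    if x == y then 1
    else - \sum_(z in A | (x <= z)%O && (z < y)%O) mobius A x z.
Proof.
have lt_card (t : T) : (#|[set z : T | (z < t)%O]| < #|T|)%N.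
  rewrite -[X in (_ < X)%N]cardsT; apply/proper_card/properP.
  by split; [exact: subsetT | exists t; rewrite inE ?ltxx].
rewrite [LHS]mobius_rec_stable //=; case: eqP => // _; congr (- _).
apply: eq_bigr => z /and3P[_ _ lt_zy]; rewrite /mobius.
rewrite !mobius_rec_stable //; apply/proper_card/properP.
split; last by exists z; rewrite inE ?ltxx.
by apply/subsetP => t; rewrite !inE => /lt_trans; apply.
Qed.

Definition is_chain (d : Order.disp_t) (T : finPOrderType d) (C : {set T}) :
    bool :=
  [forall x in C, forall y in C, (x >=< y)%O].

(* The length of a longest chain of A with top element a; this is the rank    *)
(* function when A is pure.                                                   *)
Definition rank_in (d : Order.disp_t) (T : finPOrderType d) (A : {set T})
    (a : T) : nat :=
  \max_(C : {set T} | [&& C \subset A, is_chain C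
                        & [forall c in C, (c <= a)%O]]) #|C|.-1.

Definition poset_rank (d : Order.disp_t) (T : finPOrderType d) (A : {set T}) :
    nat :=
  \max_(a in A) rank_in A a.

(* [bot] is meant to be the least element of A.                               *)
Definition charpoly (d : Order.disp_t) (T : finPOrderType d) (A : {set T})
    (bot : T) : {poly int} :=
  \sum_(a in A) mobius A bot a *: 'X^(poset_rank A - rank_in A a).

(******************************************************************************)
(* Multi-pointed partitions. The set [n] is 'I_n = {0, ..., n-1}, so that its *)
(* subset [i] is {j : 'I_n | j < i}. The family of pointed subsets is encoded *)
(* by its union S: the pointed subset of a block B is B :&: S.                *)
(******************************************************************************)

Definition is_mpp (n : nat) (p : {set {set 'I_n}} * {set 'I_n}) : bool :=
  partition p.1 [set: 'I_n] && [forall B in p.1, B :&: p.2 != set0].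

Record mpp (n : nat) : predArgType :=
  Mpp { mpp_val : {set {set 'I_n}} * {set 'I_n}; mppP : is_mpp mpp_val }.

HB.instance Definition _ (n : nat) := [isSub of mpp n for @mpp_val n].
HB.instance Definition _ (n : nat) := [Finite of mpp n by <:].

Definition blocks (n : nat) (p : mpp n) : {set {set 'I_n}} := (mpp_val p).1.
Definition pointed (n : nat) (p : mpp n) : {set 'I_n} := (mpp_val p).2.

(* q is obtained from p by gathering two blocks into one.                     *)
Definition mpp_merge (n : nat) : rel (mpp n) := fun p q =>
  [exists B1 in blocks p, exists B2 in blocks p,
    [&& B1 != B2,
        blocks q == (B1 :|: B2) |: (blocks p :\: [set B1; B2]),
        pointed q :\: (B1 :|: B2) == pointed p :\: (B1 :|: B2)
      & [|| (B1 :|: B2) :&: pointed q == B1 :&: pointed p,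
            (B1 :|: B2) :&: pointed q == B2 :&: pointed p
          | (B1 :|: B2) :&: pointed q ==
              (B1 :&: pointed p) :|: (B2 :&: pointed p)]]].

Definition mpp_le (n : nat) : rel (mpp n) := connect (@mpp_merge n).

Lemma mpp_merge_card (n : nat) (p q : mpp n) :
  mpp_merge p q -> (#|blocks q| < #|blocks p|)%N.
Proof.
case/exists_inP => B1 pB1 /exists_inP[B2 pB2 /and4P[B12 /eqP-> _ _]].
have sub12 : [set B1; B2] \subset blocks p.
  by apply/subsetP => B; rewrite !inE => /orP[] /eqP->.
have /eqP := cardsID [set B1; B2] (blocks p).
rewrite (setIidPr sub12) cards2 B12 => /eqP <-.
by rewrite cardsU1; case: (_ \notin _).
Qed.

Lemma mpp_le_card (n : nat) (p q : mpp n) :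
  mpp_le p q -> p = q \/ (#|blocks q| < #|blocks p|)%N.
Proof.
case/connectP => s; elim: s p => [|r s IHs] p /=; first by left.
case/andP => /mpp_merge_card lt_rp /IHs/[apply].
by case=> [<-|lt_qr]; right => //; apply: ltn_trans lt_rp.
Qed.

Lemma mpp_le_refl (n : nat) : reflexive (@mpp_le n).
Proof. by move=> p; apply: connect0. Qed.

Lemma mpp_le_trans (n : nat) : transitive (@mpp_le n).
Proof. by move=> q p r; apply: connect_trans. Qed.

Lemma mpp_le_anti (n : nat) : antisymmetric (@mpp_le n).
Proof.
move=> p q /andP[/mpp_le_card[//|lt_qp] /mpp_le_card[//|lt_pq]].
by have := ltn_trans lt_pq lt_qp; rewrite ltnn.
Qed.

Fact mpp_display : Order.disp_t. Proof. exact: Order.Disp. Qed.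

HB.instance Definition _ (n : nat) :=
  Order.Le_isPOrder.Build mpp_display (mpp n)
    (@mpp_le_refl n) (@mpp_le_anti n) (@mpp_le_trans n).

Lemma mpp_leE (n : nat) (p q : mpp n) : (p <= q)%O = mpp_le p q.
Proof. by []. Qed.

Lemma mpp0_subproof (n : nat) :
  is_mpp ([set [set j] | j : 'I_n], [set: 'I_n]).
Proof.
apply/andP; split=> /=; last first.
  apply/forall_inP => B /imsetP[j _ ->]; rewrite setIT.
  by apply/set0Pn; exists j; rewrite inE.
apply/and3P; split.
- apply/eqP/setP => j; rewrite inE; apply/bigcupP; exists [set j]; rewrite ?inE //.
  exact: imset_f.
- apply/trivIsetP => _ _ /imsetP[i _ ->] /imsetP[j _ ->] ij.
  by rewrite disjoints1 inE; apply: contra ij => /eqP->.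
- by apply/imsetP => -[j _ /setP/(_ j)]; rewrite !inE eqxx.
Qed.

Definition mpp0 (n : nat) : mpp n := Mpp (mpp0_subproof n).

Definition MPiA (n i : nat) : {set mpp n} :=
  [set p : mpp n | [set j : 'I_n | (j < i)%N] \subset pointed p].

(* A is the interval below some multi-pointed partition with a single block   *)
(* and i pointed elements; as this interval is only unique up to isomorphism, *)
(* the choice of the pointed elements is left open.                           *)
Definition is_MPiA' (n i : nat) (A : {set mpp n}) : Prop :=
  if i is 0%N then A = [set: mpp n]
  else exists p : mpp n,
    [/\ #|blocks p| = 1%N, #|pointed p| = i
      & A = [set q : mpp n | (mpp0 n <= q)%O && (q <= p)%O]].

Notation "x %:F" := (tofrac x) : ring_scope.

Definition angle (m : nat) : {poly int} :=
  \prod_(1 <= j < m.+1) ('X - (j%:R)%:P).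

(* Main.v *)
Require Import Defs.
From mathcomp Require Import all_boot all_order all_algebra.
From mathcomp Require Import ring zify.
Import Order.TTheory GRing.Theory Num.Theory.
Set Implicit Arguments.
Unset Strict Implicit.
Unset Printing Implicit Defensive.
Local Open Scope ring_scope.

(* All the posets involved are lower sets of the poset of multi-pointed
   partitions, whose order is: p <= q iff the blocks of p refine those of q and
   the pointed set of q meets each block C of p in the empty set or in the
   pointed subset of C.  Writing the Moebius function as a product over blocks,
   x chi(x) becomes a sum over set partitions of products of block weights, and
   the exponential formula gives, at x = - m and up to sign, the exponential
   generating functions (C / (1 - z C)) ^ m for the intervals and
   (C / (1 - z C ^ 2)) ^ m for the posets with [i] pointed, where z marks the
   pointed elements of the top (resp. the elements of [i]), y marks the other
   elements, and C = 1 + y C ^ 2 is the Catalan series.  The exponential formula is checked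
   through the recursion that removes the block containing a fixed element;
   both sides being polynomials in x, it suffices to take m a positive integer,
   where the recursion is a convolution identity for ballot numbers.  Finally,
   the formula for intervals at x = 1 is exactly the recurrence which defines
   the Moebius function. *)

(** * Ballot number identities *)

Section Nat.
Local Open Scope nat_scope.

(* The coefficient of [y ^ a] in [C ^ x], where [C = 1 + y C ^ 2] is the
   generating function of the Catalan numbers. *)
Fixpoint ballot (a x : nat) : nat :=
  if a is a'.+1 then \sum_(j < x) ballot a' j.+2 else 1.

Arguments ballot : simpl never.

Lemma ballotS0 a : ballot a.+1 0 = 0.
Proof. by rewrite /ballot big_ord0. Qed.

Lemma ballotSS a x : ballot a.+1 x.+1 = ballot a.+1 x + ballot a x.+2.
Proof. by rewrite [LHS]/ballot big_ord_recr. Qed.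

(** The closed form ballot(a, y) = y / (y + 2a) binomial(y + 2a, a), cleared of denominators at y =
    x + 1. *)
Lemma ballot_fact a x :
  ballot a x.+1 * ((x.+1 + a)`! * a`!) = x.+1 * (x + 2 * a)`!.
Proof.
elim: a x => [|a IHa] x; first by rewrite mul1n !addn0 muln1 factS.
(* Here [y] may be 0, which gives the inner induction its base. *)
suff E y : ballot a.+1 y * ((y + a.+1)`! * a.+1`!) = y * (y + (2 * a).+1)`!.
  by rewrite E; congr (_ * _`!); lia.
elim: y => [|y IHy]; first by rewrite ballotS0.
rewrite ballotSS mulnDl.
have -> : ballot a.+1 y * ((y.+1 + a.+1)`! * a.+1`!) =
  (y + a).+2 * (y * (y + (2 * a).+1)`!).
  by rewrite -IHy addSn factS addnS; ring.
have -> : ballot a y.+2 * ((y.+1 + a.+1)`! * a.+1`!) =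
  a.+1 * (y.+2 * (y + (2 * a).+1)`!).
  have := IHa y.+1; rewrite addSnnS => E.
  by rewrite -[(2 * a).+1 in RHS]add1n addnA addn1 -E (factS a); ring.
rewrite [in RHS]addSn [in RHS]factS.
ring.
Qed.

(** The recurrence on [G] is that of C^(z+1) = C^z + y C^(z+2), so the series of [G _ z] is C^z
    times that of [G _ 0], and multiplying by C^x shifts [z] by [x]. *)
Lemma ballot_convolution (G : nat -> nat -> nat) a x y :
    (forall z, G 0 z = 1) ->
    (forall b z, G b.+1 z.+1 = G b.+1 z + G b z.+2) ->
  \sum_(k < a.+1) ballot k x * G (a - k) y = G a (x + y).
Proof.
move=> G0 GS; elim: a x => [|a IHa] x.
  by rewrite big_ord1 G0 mul1n G0.
elim: x => [|x IHx].
  rewrite big_ord_recl big1 /= ?mul1n ?addn0 ?subn0 // => k _.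
  by rewrite ballotS0.
rewrite addSn GS -IHx -!addSn -IHa big_ord_recl [in RHS]big_ord_recl /= -addnA.
congr (_ + _); rewrite -big_split /=; apply: eq_bigr => k _.
by rewrite ballotSS subSS mulnDl.
Qed.

(* [C ^ r / (1 - y C) ^ t = C ^ (r + t)], since [1 - y C = 1 / C]. *)
Lemma ballot_negbin a t r :
  \sum_(l < a.+1) 'C((t + l).-1, l) * ballot (a - l) (r + l) = ballot a (r + t).
Proof.
elim: a t r => [|a IHa] t r; first by rewrite big_ord1 bin0.
elim: t => [|t IHt].
  rewrite big_ord_recl big1 /= ?bin0 ?mul1n ?addn0 ?subn0 // => l _.
  by rewrite add0n bin_small.
have := IHa t.+1 r.+1.
rewrite -[in RHS]addSnnS addSn => E.
rewrite !addnS ballotSS -IHt -E big_ord_recl [in RHS]big_ord_recl /=.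
rewrite !bin0 -addnA; congr (_ + _); rewrite -big_split /=.
by apply: eq_bigr => l _; rewrite !addnS /= binS subSS mulnDl addSn.
Qed.

Definition rising m i := \prod_(j < i) (m + j).

Lemma risingS m i : rising m i.+1 = rising m i * (m + i).
Proof. by rewrite /rising big_ord_recr. Qed.

Lemma rising_fact m i : rising m.+1 i * m`! = (m + i)`!.
Proof.
elim: i => [|i IHi]; first by rewrite /rising big_ord0 mul1n addn0.
by rewrite risingS addnS factS -IHi; ring.
Qed.

(** The derivative of (1 - z)^(-m) is m (1 - z)^(-1) (1 - z)^(-m), and [rising m i] is i! times the
    coefficient of z^i in (1 - z)^(-m). *)
Lemma rising_sum m j :
  m * \sum_(s < j.+1) j ^_ s * rising m (j - s) = rising m j.+1.
Proof.
elim: j => [|j IHj].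
  by rewrite big_ord1 ffactn0 /rising big_ord0 big_ord1 addn0 !muln1.
rewrite big_ord_recl ffactn0 subn0 mul1n mulnDr [in RHS]risingS.
under eq_bigr => s _ do rewrite /= ffactnS subSS -mulnA.
rewrite -big_distrr /= mulnCA IHj; ring.
Qed.

(* The coefficient of the first power of [m] in [set_weight c m a i] below. *)
Definition block_weight (c a i : nat) : nat :=
  if i is i'.+1 then i'`! * a`! * ballot a (c * i)
  else a.-1`! * 'C(a.-1 + a, a).

(* [a! i!] times the coefficient of [y ^ a z ^ i] in
   [(C / (1 - z C ^ c)) ^ m]. *)
Definition set_weight (c m a i : nat) : nat :=
  rising m i * a`! * ballot a (m + c * i).

(** Removal of the block of a distinguished z-element, with [k] y-elements and [s] further
    z-elements. The sum over [s] is [rising_sum]; the sum over [k] is a convolution of powers of C,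
    whose exponent is shared between the block and the rest. *)
Lemma set_weight_pointed c m a j :
  set_weight c m a j.+1 =
  \sum_(k < a.+1) \sum_(s < j.+1) 'C(a, k) * 'C(j, s) *
    (m * block_weight c k s.+1 * set_weight c m (a - k) (j - s)).
Proof.
rewrite exchange_big /= /set_weight -rising_sum -!mulnA big_distrl.
rewrite big_distrr /=; apply: eq_bigr => s _.
have le_sj : s <= j by rewrite -ltnS.
have -> : m + c * j.+1 = c * s.+1 + (m + c * (j - s)) by nia.
rewrite -(@ballot_convolution ballot) //; last by move=> b z; apply: ballotSS.
rewrite !big_distrr /=; apply: eq_bigr => k _.
have le_ka : k <= a by rewrite -ltnS.
rewrite -(bin_fact le_ka) -bin_ffact.
move: (ballot _ _) (ballot _ _) (rising _ _) (a - k)`! k`! s`! => b1 b2 r f1 f2 f3.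
move: 'C(a, k) 'C(j, s) => c1 c2; ring.
Qed.

(* The case [x = m], [y = 0] of the convolution of [C ^ x] with
   [C ^ y / (1 - 2 y C)], whose coefficients are ['C(y + 2 * b, b)]. *)
Lemma bin_central_convolution a m :
  \sum_(k < a.+1) ballot k m * 'C(2 * (a - k), a - k) = 'C(m + 2 * a, a).
Proof.
rewrite -[m in RHS]addn0.
rewrite -(@ballot_convolution (fun b y => 'C(y + 2 * b, b)) a m 0) //.
- by move=> z; rewrite bin0.
move=> b z; rewrite addSn binS; congr (_ + 'C(_, _)).
by lia.
Qed.

(** Removal of the block of a distinguished y-element when there is no z-element. This is (C^m)' = m
    (log C)' C^m in coefficients, those of (log C)' being ['C(k + k.+1, k.+1)]. *)
Lemma set_weight_unpointed c m a :
  set_weight c m.+1 a.+1 0 =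
  \sum_(k < a.+1) 'C(a, k) *
    (m.+1 * block_weight c k.+1 0 * set_weight c m.+1 (a - k) 0).
Proof.
(* This is 1 + 2 y (log C)' = 1 / (1 - 2 y C), the series of the central binomials, multiplied by
   C^(m+1). *)
have E : ballot a.+1 m.+1 +
    2 * (\sum_(k < a.+1) 'C(k + k.+1, k.+1) * ballot (a - k) m.+1)
   = 'C(m.+1 + 2 * a.+1, a.+1).
  rewrite -bin_central_convolution [RHS]big_ord_recr subnn muln0 bin0 muln1.
  rewrite [RHS]addnC; congr (_ + _).
  rewrite big_distrr (reindex_inj rev_ord_inj) /=.
  apply: eq_bigr => k _; have le_ka : k <= a by rewrite -ltnS.
  rewrite subSS subKn // subSn // mulnA mulnC; congr (_ * _).
  have -> : 2 * (a - k).+1 = ((a - k) + (a - k).+1).+1 by lia.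
  rewrite binS -[X in _ = _ + X]bin_sub; last by lia.
  by rewrite addKn mul2n addnn.
rewrite /set_weight /rising big_ord0.
set S := \sum_(_ < _) _ in E; transitivity (m.+1 * a`! * S); last first.
  rewrite big_distrr /=; apply: eq_bigr => k _.
  have le_ka : k <= a by rewrite -ltnS.
  rewrite muln0 addn0 -(bin_fact le_ka).
  move: (ballot _ _) (a - k)`! k`! 'C(_, _) 'C(_, _) => b f1 f2 c1 c2; ring.
rewrite muln0 addn0 mul1n.
have := ballot_fact a.+1 m; set b := ballot a.+1 _ in E *.
move=> B.
have : (b + 2 * S) * ((m.+1 + a.+1)`! * a.+1`!) = (m.+1 + 2 * a.+1)`!.
  rewrite E -[RHS](@bin_fact _ a.+1); last by lia.
  congr (_ * _); rewrite mulnC; congr (_ * _`!); lia.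
rewrite [in RHS]addSn [in RHS]factS => E2.
(* Eliminating the binomial by the closed form of [b] leaves a linear relation between [S] and
   [b]. *)
have {}E2 : m.+1 * (b + 2 * S) * ((m.+1 + a.+1)`! * a.+1`!) =
    (m + 2 * a.+1).+1 * b * ((m.+1 + a.+1)`! * a.+1`!).
  by rewrite -mulnA E2 -[in RHS]mulnA B mulnCA.
have N0 : 0 < (m.+1 + a.+1)`! * a.+1`! by rewrite muln_gt0 !fact_gt0.
move/eqP: E2; rewrite eqn_pmul2r // => /eqP E2.
have {}E2: m.+1 * S = a.+1 * b by lia.
by rewrite factS mulnAC -E2 mulnAC.
Qed.

(** The closed form turns the term with j unpointed elements into (b-1)! binomial(b-1+j, b-1), and
    the hockey-stick identity sums these. This treats a block none of whose elements is forced to be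
    pointed. *)
Lemma block_weight_sum0 b :
  0 < b ->
  \sum_(k < b) 'C(b, k.+1) * block_weight 1 (b - k.+1) k.+1 = block_weight 2 b 0.
Proof.
case: b => // b _; rewrite /block_weight /=.
transitivity (b`! * \sum_(k < b.+1) 'C(b + k, b)).
  rewrite big_distrr (reindex_inj rev_ord_inj) /=.
  apply: eq_bigr => k _; have le_kb : k <= b by rewrite -ltnS.
  rewrite !subSS subKn // mul1n.
  have := ballot_fact k (b - k).
  have -> : (b - k).+1 + k = b.+1 by lia.
  have -> : b - k + 2 * k = b + k by lia.
  rewrite -(@bin_fact (b + k) b) ?leq_addr // addKn => E.
  have := @bin_fact b.+1 (b - k).+1 ltac:(lia).
  have -> : b.+1 - (b - k).+1 = k by lia.
  rewrite (factS (b - k)) => E1.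
  apply/eqP; rewrite -(eqn_pmul2r (fact_gt0 k)) -(@eqn_pmul2r (b - k).+1) //.
  apply/eqP; transitivity (ballot k (b - k).+1 * (b.+1`! * k`!)).
    rewrite -E1; move: (ballot _ _) (_)`! (_)`! 'C(_, _) => ? ? ? ?; ring.
  by rewrite E mulnC; congr (_ * _); rewrite mulnA [in RHS](mulnC b`!).
suff hockey k : \sum_(j < k.+1) 'C(b + j, b) = 'C(b + k.+1, b.+1) by rewrite hockey.
elim: k => [|k IHk]; first by rewrite big_ord1 addn0 binn addn1 binn.
by rewrite big_ord_recr /= IHk [in RHS]addnS [in RHS]binS addnC.
Qed.

(** This is [ballot_negbin] with both exponents [t.+1]. In a block with [t.+1] elements forced to be
    pointed, [l] of the [a] others are pointed as well; summing over them doubles the exponent of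
    C. *)
Lemma block_weight_sumS a t :
  \sum_(l < a.+1) 'C(a, l) * block_weight 1 (a - l) (t.+1 + l) =
  block_weight 2 a t.+1.
Proof.
rewrite [RHS]/= mul2n -addnn -ballot_negbin big_distrr /=.
apply: eq_bigr => l _; have le_la : l <= a by rewrite -ltnS.
rewrite -(bin_fact le_la) -(bin_fact (leq_addl t l)) addnK mul1n.
move: (ballot _ _) (_ - _)`! l`! t`! 'C(_, _) 'C(_, _) => ? ? ? ? ? ?; ring.
Qed.

End Nat.

(** * Sums over set partitions *)

Section PartitionSum.
Variables (T : finType) (R : comNzRingType).
Implicit Types (U V W B S : {set T}) (P : {set {set T}}).

Lemma sum_subset_split (G : {set T} -> R) U V : V \subset U ->
  \sum_(S : {set T} | S \subset U) G S =
  \sum_(S1 : {set T} | S1 \subset V)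
    \sum_(S2 : {set T} | S2 \subset U :\: V) G (S1 :|: S2).
Proof.
move=> sVU; rewrite pair_big_dep /=.
rewrite (reindex_onto (fun p => p.1 :|: p.2) (fun S => (S :&: V, S :\: V))) /=.
  apply: eq_bigl => -[S1 S2] /=; apply/andP/andP => -[].
    move=> sSU /eqP[E1 E2]; rewrite -{1}E1 -{2}E2.
    by rewrite subsetIr setSD.
  rewrite subsetD => sS1 /andP[sS2 dS2].
  rewrite subUset sS2 (subset_trans sS1 sVU); split=> //.
  rewrite setIUl setDUl (setIidPl sS1) (setDidPl dS2).
  have /eqP-> : S2 :&: V == set0 by rewrite setI_eq0.
  have /eqP-> : S1 :\: V == set0 by rewrite setD_eq0.
  by rewrite setU0 set0U.
by move=> S _; rewrite setID.
Qed.

Lemma sum_subset_mem (G : {set T} -> R) U u : u \in U ->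
  \sum_(B : {set T} | (B \subset U) && (u \in B)) G B =
  \sum_(S : {set T} | S \subset U :\ u) G (u |: S).
Proof.
move=> uU; rewrite (reindex_onto (fun S => u |: S) (fun B => B :\ u)) /=.
  apply: eq_bigl => S; rewrite setU11 andbT subUset sub1set uU /= subsetD1.
  apply: andb_id2l => _; apply/eqP/idP => [<-|]; first by rewrite !inE eqxx.
  exact: setU1K.
by move=> B /andP[_ uB]; rewrite setD1K.
Qed.

Lemma sum_subset_card (phi : nat -> R) U :
  \sum_(S : {set T} | S \subset U) phi #|S| =
  \sum_(k < #|U|.+1) 'C(#|U|, k)%:R * phi k.
Proof.
rewrite (partition_big (fun S : {set T} => inord #|S| : 'I_#|U|.+1) xpredT) //=.
apply: eq_bigr => k _; rewrite -cards_draws mulr_natl -sumr_const.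
have E S : (S \subset U) && (inord #|S| == k) =
    (S \in [set A : {set T} | A \subset U & #|A| == k]).
  rewrite inE; apply: andb_id2l => sSU.
  by rewrite -val_eqE /= inordK // ltnS subset_leq_card.
rewrite (eq_bigl _ _ E); apply: eq_bigr => S.
by rewrite inE => /andP[_ /eqP->].
Qed.

Definition partition_sum (h : {set T} -> R) U : R :=
  \sum_(P | partition P U) \prod_(B in P) h B.

Lemma eq_partition_sum (h1 h2 : {set T} -> R) U :
  (forall B, B != set0 -> h1 B = h2 B) ->
  partition_sum h1 U = partition_sum h2 U.
Proof.
move=> E; apply: eq_bigr => P partP; apply: eq_bigr => B PB.
by apply: E; apply: contraTneq PB => ->; case/and3P: partP.
Qed.

Lemma partition_sum0 h : partition_sum h set0 = 1.
Proof.
rewrite /partition_sum (big_pred1 set0) ?big_set0 // => P.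
by rewrite partition_set0.
Qed.

Lemma partition_sum_rec h U u : u \in U ->
  partition_sum h U =
  \sum_(B : {set T} | (B \subset U) && (u \in B)) h B * partition_sum h (U :\: B).
Proof.
move=> uU; rewrite /partition_sum.
rewrite (partition_big (fun P => pblock P u)
  (fun B : {set T} => (B \subset U) && (u \in B))); last first.
  move=> P partP; have uP : u \in cover P by rewrite (cover_partition partP).
  rewrite mem_pblock uP andbT; apply: (partitionS partP).
  exact: pblock_mem.
apply: eq_bigr => B /andP[sBU uB]; rewrite big_distrr /=.
have Bn0 : B != set0 by apply/set0Pn; exists u.
rewrite (reindex_onto (fun P => B |: P) (fun P => P :\ B)) /=.
  rewrite (eq_bigl (fun P => partition P (U :\: B))); last first.
    move=> P; apply/andP/idP => [[/andP[partP /eqP defB] /eqP defP]|partP].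
      by have := partitionD1 partP (setU11 B P); rewrite defP.
    have dBP : [disjoint B & U :\: B].
      by rewrite disjoint_sym disjoints_subset setDE subsetIr.
    have nBP : B \notin P.
      apply: contraTN dBP => PB; rewrite -setI_eq0.
      by rewrite (setIidPl (partitionS partP PB)).
    have partBP := partitionU1 partP Bn0 dBP.
    have E : B :|: (U :\: B) = U by rewrite -{1}(setIidPr sBU) setID.
    rewrite E in partBP; rewrite partBP setU1K // eqxx.
    by split=> //; apply/eqP/def_pblock; rewrite ?setU11 //; case/and3P: partBP.
  apply: eq_bigr => P partP; rewrite big_setU1 //=.
  apply: contraL uB => PB; move: (partitionS partP PB).
  by move/subsetP/(_ u); rewrite !inE; case: (u \in B) => //= /(_ isT).
move=> P /andP[partP /eqP <-]; rewrite setD1K //.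
by apply: pblock_mem; rewrite (cover_partition partP).
Qed.

(** Choosing a subset of each block amounts to choosing one subset of [U], as in the encoding of the
    pointed subsets by their union. *)
Lemma prod_block_sum (g : {set T} -> {set T} -> R) P U : partition P U ->
  \prod_(B in P) (\sum_(S : {set T} | S \subset B) g B S) =
  \sum_(S : {set T} | S \subset U) \prod_(B in P) g B (B :&: S).
Proof.
have [m] := ubnP #|P|; elim: m => // m IHm in P U *.
rewrite ltnS => le_Pm partP; have [P0|[B PB]] := set_0Vmem P.
  move: partP; rewrite P0 big_set0 => /cover_partition <-.
  by rewrite /cover big_set0 (big_pred1 set0) ?big_set0 // => S; rewrite subset0.
have part' := partitionD1 partP PB.
rewrite (sum_subset_split _ (partitionS partP PB)).
rewrite (big_setD1 B PB) /= (IHm _ _ _ part'); last first.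
  by apply: leq_trans le_Pm; rewrite [X in (_ < X)%N](cardsD1 B) PB.
rewrite big_distrl /=; apply: eq_bigr => S1 sS1B.
rewrite big_distrr /=; apply: eq_bigr => S2; rewrite subsetD => /andP[_ dS2B].
rewrite (big_setD1 B PB) /=; congr (g B _ * _).
  rewrite setIUr (setIidPr sS1B); apply/esym/setUidPl.
  by rewrite setIC (eqP (_ : S2 :&: B == set0)) ?sub0set // setI_eq0.
apply: eq_bigr => C; rewrite 2!inE => /andP[nCB PC]; congr (g C _).
rewrite setIUr (_ : C :&: S1 = set0) ?set0U //.
have /and3P[_ /trivIsetP tI _] := partP; apply/eqP; rewrite setI_eq0.
exact: disjointWr sS1B (tI C B PC PB nCB).
Qed.

(** Both sides obey the same block-removal recursion: the weight vanishes on sets that lie in no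
    block of [P], so the removed block affects the factor of a single [D]. The recursion for [F] is
    assumed for one [u] in each [U], as its proof has to choose [u]. *)
Lemma partition_sum_refine (h F : {set T} -> R) P :
    partition P [set: T] -> F set0 = 1 ->
    (forall U, U != set0 -> exists2 u, u \in U &
       F U = \sum_(B : {set T} | (B \subset U) && (u \in B)) h B * F (U :\: B)) ->
  forall U,
  partition_sum (fun B => if [exists D in P, B \subset D] then h B else 0) U =
  \prod_(D in P) F (D :&: U).
Proof.
move=> partP F0 FE U; have [m] := ubnP #|U|; elim: m => // m IHm in U *.
rewrite ltnS => le_Um; have [->|[u0 u0U]] := set_0Vmem U.
  by rewrite partition_sum0 big1 // => D _; rewrite setI0.
have /and3P[_ tI _] := partP.
have PT z : z \in cover P by rewrite (cover_partition partP) inE.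
set D := pblock P u0; have PD : D \in P by apply: pblock_mem.
have [|u] := FE (D :&: U).
  by apply/set0Pn; exists u0; rewrite inE mem_pblock PT.
rewrite inE => /andP[uD uU] FDU; rewrite (partition_sum_rec _ uU).
rewrite (big_setD1 D PD) /= FDU big_distrl /= [RHS]big_mkcond.
rewrite [LHS]big_mkcond; apply: eq_bigr => B _; rewrite subsetI.
have [uB|] := boolP (u \in B); last by rewrite !andbF.
rewrite !andbT; have [sBU|] := boolP (B \subset U); last by rewrite andbF.
rewrite andbT; have [sBD|nsBD] := boolP (B \subset D); last first.
  rewrite ifN ?mul0r //; apply: contra nsBD => /exists_inP[D' PD' sBD'].
  by rewrite -(def_pblock tI PD uD) (def_pblock tI PD' (subsetP sBD' u uB)).
rewrite ifT; last by apply/exists_inP; exists D.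
rewrite IHm; last first.
  apply: leq_trans le_Um; apply: proper_card; apply/properP.
  by split; [apply: subsetDl | exists u; rewrite ?inE ?uB].
rewrite (big_setD1 D PD) /= mulrA setIDA; congr (_ * _).
apply: eq_bigr => C; rewrite !inE => /andP[nCD PC]; congr (F _).
rewrite setIDA; apply/setDidPl.
have /trivIsetP/(_ C D PC PD nCD) dCD := tI.
exact: disjointWl (subsetIl _ _) (disjointWr sBD dCD).
Qed.

End PartitionSum.

(** * Sums over the block of a fixed element *)

Section Counting.
Variables (T : finType) (R : comNzRingType).
Implicit Types (U B X : {set T}).

Lemma sum_pointed_card (phi : nat -> nat -> R) U X u : u \in U :&: X ->
  \sum_(B : {set T} | (B \subset U) && (u \in B)) phi #|B :\: X| #|B :&: X| =
  \sum_(k < #|U :\: X|.+1) \sum_(s < #|U :&: X|)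
    ('C(#|U :\: X|, k) * 'C(#|U :&: X|.-1, s))%N%:R * phi k s.+1.
Proof.
move=> uUX; have /setIP[uU uX] := uUX.
rewrite (sum_subset_mem _ uU) (@sum_subset_split _ _ _ _ (U :\: X)); last first.
  by rewrite subsetD1 subsetDl !inE uX.
have -> : (U :\ u) :\: (U :\: X) = (U :&: X) :\ u.
  by apply/setP=> z; rewrite !inE; case: (z == u); case: (z \in X); case: (z \in U).
transitivity (\sum_(S1 : {set T} | S1 \subset U :\: X)
    \sum_(S2 : {set T} | S2 \subset (U :&: X) :\ u) phi #|S1| #|S2|.+1).
  apply: eq_bigr => S1; rewrite subsetD => /andP[_ dS1].
  apply: eq_bigr => S2; rewrite subsetD1 subsetI => /andP[/andP[_ sS2] uS2].
  congr (phi #|pred_of_set _| _).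
    apply/setP=> z; have := disjointFr dS1 (x := z); have := subsetP sS2 z.
    have : (z == u) -> z \in X by move/eqP->.
    rewrite !inE; case: (z == u); case: (z \in S1); case: (z \in S2);
      by case: (z \in X) => //=; do ?[by move/(_ isT) | move=> _].
  have -> : (u |: (S1 :|: S2)) :&: X = u |: S2.
    apply/setP=> z; have := disjointFr dS1 (x := z); have := subsetP sS2 z.
    have : (z == u) -> z \in X by move/eqP->.
    rewrite !inE; case: (z == u); case: (z \in S1); case: (z \in S2);
      by case: (z \in X) => //=; do ?[by move/(_ isT) | move=> _].
  by rewrite cardsU1 uS2.
rewrite (sum_subset_card (fun k => \sum_(S2 : {set T} | S2 \subset _) phi k #|S2|.+1)).
apply: eq_bigr => k _.
rewrite (sum_subset_card (fun s => phi k s.+1)) big_distrr.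
have -> : #|U :&: X| = #|(U :&: X) :\ u|.+1 by rewrite [LHS](cardsD1 u) uUX.
by apply: eq_bigr => s _; rewrite /= natrM mulrA.
Qed.

Lemma sum_mem_card (phi : nat -> R) U u : u \in U ->
  \sum_(B : {set T} | (B \subset U) && (u \in B)) phi #|B| =
  \sum_(k < #|U|) 'C(#|U|.-1, k)%:R * phi k.+1.
Proof.
move=> uU; rewrite (sum_subset_mem _ uU).
transitivity (\sum_(S : {set T} | S \subset U :\ u) phi #|S|.+1).
  by apply: eq_bigr => S; rewrite subsetD1 => /andP[_ uS]; rewrite cardsU1 uS.
rewrite (sum_subset_card (fun k => phi k.+1)).
by have -> : #|U| = #|U :\ u|.+1 by rewrite [LHS](cardsD1 u) uU.
Qed.

End Counting.

(** The element [u] is taken in [X] as soon as [U] meets [X], so that [set_weight_pointed] applies;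
    otherwise [set_weight_unpointed] does. As [u] does not depend on [m], the recursion passes to
    polynomials. *)
Lemma set_weight_rec (T : finType) c (X U : {set T}) : U != set0 ->
  exists2 u, u \in U & forall m,
  (set_weight c m.+1 #|U :\: X| #|U :&: X|)%:R =
  \sum_(B : {set T} | (B \subset U) && (u \in B))
    (m.+1 * block_weight c #|B :\: X| #|B :&: X| *
     set_weight c m.+1 #|(U :\: B) :\: X| #|(U :\: B) :&: X|)%N%:R :> int.
Proof.
move=> Un0.
have cardD (B : {set T}) : B \subset U ->
    #|(U :\: B) :\: X| = (#|U :\: X| - #|B :\: X|)%N /\
    #|(U :\: B) :&: X| = (#|U :&: X| - #|B :&: X|)%N.
  move=> sBU; have -> : (U :\: B) :\: X = (U :\: X) :\: (B :\: X).
    by apply/setP=> z; rewrite !inE; case: (z \in X); case: (z \in B).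
  have -> : (U :\: B) :&: X = (U :&: X) :\: (B :&: X).
    apply/setP=> z; rewrite !inE.
    by case: (z \in X); case: (z \in B); rewrite /= ?andbF ?andbT.
  by rewrite !cardsD (setIidPr (setSD X sBU)) (setIidPr (setSI X sBU)) -!cardsD.
have [UX0|[u uUX]] := set_0Vmem (U :&: X); last first.
  exists u => [|m]; first by case/setIP: uUX.
  pose phi a i : int := (m.+1 * block_weight c a i *
    set_weight c m.+1 (#|U :\: X| - a) (#|U :&: X| - i))%N%:R.
  transitivity (\sum_(B : {set T} | (B \subset U) && (u \in B))
     phi #|B :\: X| #|B :&: X|); last first.
    by apply: eq_bigr => B /andP[/cardD[-> ->] _].
  rewrite (sum_pointed_card _ uUX) /phi (cardsD1 u (U :&: X)) uUX add1n.
  rewrite set_weight_pointed natr_sum; apply: eq_bigr => k _.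
  by rewrite natr_sum; apply: eq_bigr => s _; rewrite natrM subSS.
have [u uU] := set0Pn _ Un0; exists u => // m.
have dUX : U :\: X = U by apply/setDidPl; rewrite -setI_eq0 UX0.
pose phi a : int := (m.+1 * block_weight c a 0 * set_weight c m.+1 (#|U| - a) 0)%N%:R.
transitivity (\sum_(B : {set T} | (B \subset U) && (u \in B)) phi #|B|).
  rewrite (sum_mem_card _ uU) /phi UX0 dUX cards0 (cardsD1 u U) uU add1n.
  rewrite set_weight_unpointed natr_sum; apply: eq_bigr => k _.
  by rewrite natrM subSS.
apply: eq_bigr => B /andP[sBU _]; have [-> ->] := cardD B sBU.
rewrite UX0 dUX cards0 sub0n /phi.
have BX0 : B :&: X = set0 by apply/eqP; rewrite -subset0 -UX0 setSI.
by rewrite BX0 cards0 (_ : B :\: X = B) //; apply/setDidPl; rewrite -setI_eq0 BX0.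
Qed.

(** * Polynomial form of the set weights *)

Lemma poly_eq_neg_nat (p q : {poly int}) :
  (forall m : nat, p.[- m.+1%:R] = q.[- m.+1%:R]) -> p = q.
Proof.
move=> E; apply/eqP; rewrite -subr_eq0; apply: contraT => pq0.
pose s : seq int := [seq - m.+1%:R | m <- iota 0 (size (p - q))].
have : (size s < size (p - q)%R)%N.
  apply: max_poly_roots pq0 _ _.
    by apply/allP => _ /mapP[m _ ->]; rewrite rootE hornerD hornerN E subrr.
  rewrite map_inj_uniq ?iota_uniq // => a b /oppr_inj/eqP.
  by rewrite eqr_nat eqSS => /eqP.
by rewrite size_map size_iota ltnn.
Qed.

(* Up to sign, [set_weight c m a i] as a polynomial in ['X = - m]. *)
Definition set_poly (c a i : nat) : {poly int} :=
  \prod_(j < i) ('X - (j%:R)%:P) *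
  (if a is a'.+1 then
     ('X - ((c * i)%N%:R)%:P) * \prod_(j < a') ('X - ((c * i + a + j.+1)%N%:R)%:P)
   else 1).

Lemma horner_prod_neg k (f : nat -> nat) (m : nat) :
  (\prod_(j < k) ('X - ((f j)%:R)%:P)).[- m%:R] =
  (-1) ^+ k * (\prod_(j < k) (m + f j))%N%:R :> int.
Proof.
elim: k => [|k IHk]; first by rewrite !big_ord0 hornerC mulr1.
rewrite !big_ord_recr /= hornerM IHk hornerXsubC natrM natrD exprS; ring.
Qed.

(** The closed form of ballot numbers as a product polynomial in [y], which yields the factors of
    [set_poly]. *)
Lemma ballot_rising a y :
  (a.+1`! * ballot a.+1 y.+1 = y.+1 * rising (y.+1 + a.+2) a)%N.
Proof.
have F0 := fact_gt0 (y.+1 + a.+1).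
apply/eqP; rewrite -(eqn_pmul2r F0); apply/eqP.
have := ballot_fact a.+1 y; have := rising_fact (y.+1 + a.+1) a.
rewrite -addnS => R.
have -> : (y + 2 * a.+1 = y.+1 + a.+1 + a)%N by lia.
by rewrite -R => B; rewrite -[RHS]mulnA -B; ring.
Qed.

Lemma horner_set_poly c a i m :
  (set_poly c a i).[- m.+1%:R] = (-1) ^+ (a + i) * (set_weight c m.+1 a i)%:R.
Proof.
rewrite /set_poly hornerM (horner_prod_neg _ id) /set_weight -/(rising m.+1 i).
case: a => [|a]; first by rewrite hornerC !mulr1 !muln1.
rewrite hornerM hornerXsubC (horner_prod_neg _ (fun j => c * i + a.+1 + j.+1)%N).
have -> : (\prod_(j < a) (m.+1 + (c * i + a.+1 + j.+1)))%N =
    rising ((m + c * i).+1 + a.+2) a.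
  by apply: eq_bigr => j _; lia.
rewrite -mulnA addSn ballot_rising !natrM -!natr1 natrD exprD exprS; ring.
Qed.

Lemma set_poly00 c : set_poly c 0 0 = 1.
Proof. by rewrite /set_poly big_ord0 mulr1. Qed.

(* [block_coef 1 a i] is the Moebius number of the interval below a single block
   with [i] pointed and [a] unpointed elements, when [0 < i]. *)
Definition block_coef (c a i : nat) : int :=
  (-1) ^+ (a + i).-1 * (block_weight c a i)%:R.

Lemma set_poly_rec (T : finType) c (X U : {set T}) : U != set0 ->
  exists2 u, u \in U &
  set_poly c #|U :\: X| #|U :&: X| =
  \sum_(B : {set T} | (B \subset U) && (u \in B))
    ('X * (block_coef c #|B :\: X| #|B :&: X|)%:P) *
    set_poly c #|(U :\: B) :\: X| #|(U :\: B) :&: X|.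
Proof.
move=> Un0; have [u uU E] := set_weight_rec c X Un0; exists u => //.
apply: poly_eq_neg_nat => m; rewrite horner_set_poly E horner_sum big_distrr.
apply: eq_bigr => B /andP[sBU uB]; rewrite /= hornerM hornerM hornerX hornerC.
have cardX (V : {set T}) : (#|V :\: X| + #|V :&: X| = #|V|)%N.
  by rewrite addnC cardsID.
rewrite horner_set_poly /block_coef !cardX.
(* The exponent [#|B|.-1] in [block_coef] is one short; the missing sign is that of ['X] at
   [- m.+1]. *)
have -> : #|U| = ((#|B|.-1).+1 + #|U :\: B|)%N.
  rewrite prednK; first by rewrite -(cardsID B U) (setIidPr sBU).
  by rewrite card_gt0; apply/set0Pn; exists u.
rewrite !natrM exprD exprS; ring.
Qed.

(** * The order and the rank *)

Section Mpp.
Variable n : nat.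
Implicit Types (p q r a z : mpp n) (A : {set mpp n}) (B C D S : {set 'I_n}).

Lemma mpp_partition p : partition (blocks p) [set: 'I_n].
Proof. by case/andP: (mppP p). Qed.

Lemma mpp_pointed p B : B \in blocks p -> B :&: pointed p != set0.
Proof. by case/andP: (mppP p) => _ /forall_inP; apply. Qed.

Lemma mpp_ext p q : blocks p = blocks q -> pointed p = pointed q -> p = q.
Proof.
rewrite /blocks /pointed => E1 E2; apply: val_inj => /=.
by case: (mpp_val p) (mpp_val q) E1 E2 => [? ?] [? ?] /= -> ->.
Qed.

Lemma mpp_blockP p (x : 'I_n) : exists2 B, B \in blocks p & x \in B.
Proof.
have xp : x \in cover (blocks p) by rewrite (cover_partition (mpp_partition p)) inE.
by exists (pblock (blocks p) x); rewrite ?pblock_mem ?mem_pblock.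
Qed.

Lemma mpp_block_eq p B C x :
  B \in blocks p -> C \in blocks p -> x \in B -> x \in C -> B = C.
Proof.
have /and3P[_ tI _] := mpp_partition p => pB pC xB xC.
by rewrite -(def_pblock tI pB xB) (def_pblock tI pC xC).
Qed.

Lemma mpp_disjoint p B C :
  B \in blocks p -> C \in blocks p -> B != C -> B :&: C = set0.
Proof.
move=> pB pC nBC; apply/eqP; apply: contraNT nBC => /set0Pn[x /setIP[xB xC]].
apply/eqP; exact: mpp_block_eq pB pC xB xC.
Qed.

Lemma mpp_block_neq0 p B : B \in blocks p -> B != set0.
Proof.
by move/mpp_pointed; apply: contra_neq => ->; rewrite set0I.
Qed.

Definition mpp_below p q :=
  [forall C in blocks p, [exists D in blocks q, C \subset D] &&
    ((C :&: pointed q == set0) || (C :&: pointed q == C :&: pointed p))].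

Lemma mpp_belowP p q :
  reflect (forall C, C \in blocks p ->
             (exists2 D, D \in blocks q & C \subset D) /\
             (C :&: pointed q = set0 \/ C :&: pointed q = C :&: pointed p))
    (mpp_below p q).
Proof.
apply: (iffP forall_inP) => H C /H.
  by case/andP => /exists_inP E /orP[]/eqP; split; auto.
case=> E1 E2; apply/andP; split; first exact/exists_inP.
by case: E2 => ->; rewrite eqxx ?orbT.
Qed.

Lemma mpp_below_trans q p r : mpp_below p q -> mpp_below q r -> mpp_below p r.
Proof.
move=> /mpp_belowP pq /mpp_belowP qr; apply/mpp_belowP => C /pq[[D qD sCD] EC].
have [[E rE sDE] ED] := qr D qD; split.
  by exists E => //; apply: subset_trans sDE.
have CD S : C :&: S = C :&: (D :&: S) by rewrite setIA (setIidPl sCD).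
rewrite CD; case: ED => ->; first by left; rewrite setI0.
by rewrite -CD.
Qed.

Lemma mpp_merge_below p q : mpp_merge p q -> mpp_below p q.
Proof.
case/exists_inP => B1 pB1 /exists_inP[B2 pB2].
case/and4P => B12 /eqP Eb /eqP Ep X; apply/mpp_belowP => C pC.
have d12 : B1 :&: B2 = set0 := mpp_disjoint pB1 pB2 B12.
have [C12|] := boolP (C \in [set B1; B2]).
  have sC : C \subset B1 :|: B2.
    by case/set2P: C12 => ->; rewrite ?subsetUl ?subsetUr.
  split; first by exists (B1 :|: B2); rewrite // Eb setU11.
  have EC S : C :&: S = C :&: ((B1 :|: B2) :&: S) by rewrite setIA (setIidPl sC).
  rewrite EC; case/set2P: C12 => ->.
    case/or3P: X => /eqP->; rewrite ?setIUr ?setIA ?setIid ?d12 ?set0I ?setU0; auto.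
  rewrite setIC in d12.
  by case/or3P: X => /eqP->; rewrite ?setIUr ?setIA ?setIid ?d12 ?set0I ?set0U; auto.
move=> nC; split; first by exists C; rewrite // Eb !inE pC andbT -in_set2 nC orbT.
have EC S : C :&: S = C :&: (S :\: (B1 :|: B2)).
  move: nC; rewrite in_set2 negb_or => /andP[n1 n2].
  rewrite setIDA; apply/esym/setDidPl.
  rewrite disjoints_subset setCU subsetI -!disjoints_subset -!setI_eq0.
  by rewrite !(setIAC C S) (mpp_disjoint pC pB1 n1) (mpp_disjoint pC pB2 n2) !set0I eqxx.
by right; rewrite EC Ep -EC.
Qed.

(** Two blocks of [p] inside a common block of [q] are gathered. If there are none, [p] and [q] have
    the same blocks, and then the same pointed subsets because those of [q] are non-empty. *)
Lemma mpp_below_merge p q : mpp_below p q -> p != q ->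
  exists2 r, mpp_merge p r & mpp_below r q.
Proof.
move=> /mpp_belowP pq npq.
have [[B1 B2] /= /and4P[pB1 pB2 B12 /exists_inP[D qD /andP[s1 s2]]]|none] :=
  pickP (fun b => [&& b.1 \in blocks p, b.2 \in blocks p, b.1 != b.2
    & [exists D in blocks q, (b.1 \subset D) && (b.2 \subset D)]]).
  have d12 : B1 :&: B2 = set0 := mpp_disjoint pB1 pB2 B12.
  (* The pointed subset of the new block is its trace on [pointed q]; if the trace is empty, the
     pointed subset of [B1] will do. *)
  pose X := if (B1 :|: B2) :&: pointed q == set0 then B1 :&: pointed p
            else (B1 :|: B2) :&: pointed q.
  have Xn0 : X != set0 by rewrite /X; case: ifP => [_|/negbT //]; apply: mpp_pointed.
  have sX : X \subset B1 :|: B2.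
    rewrite /X; case: ifP => _; last exact: subsetIl.
    exact: subset_trans (subsetIl _ _) (subsetUl _ _).
  pose bl := (B1 :|: B2) |: (blocks p :\: [set B1; B2]).
  pose pt := (pointed p :\: (B1 :|: B2)) :|: X.
  have X12 : (B1 :|: B2) :&: pt = X.
    rewrite /pt setIUr setIDA setIC -setIDA setDv setI0 set0U.
    exact/setIidPr.
  have disj C : C \in blocks p -> C \notin [set B1; B2] -> C :&: (B1 :|: B2) = set0.
    move=> pC; rewrite in_set2 negb_or => /andP[n1 n2].
    by rewrite setIUr (mpp_disjoint pC pB1 n1) (mpp_disjoint pC pB2 n2) setU0.
  have ptC C : C \in blocks p -> C \notin [set B1; B2] -> C :&: pt = C :&: pointed p.
    move=> pC nC; have C0 := disj C pC nC.
    have CX : C :&: X = set0.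
      by apply/eqP; rewrite -subset0 -C0 setIS.
    rewrite /pt setIUr CX setU0 setIDA; apply/setDidPl.
    by rewrite -setI_eq0 setIAC C0 set0I.
  have r_mpp : is_mpp (bl, pt).
    apply/andP; split=> /=; last first.
      apply/forall_inP => C; rewrite in_setU1 => /predU1P[->|]; first by rewrite X12.
      by rewrite in_setD => /andP[nC pC]; rewrite ptC // mpp_pointed.
    have part1 := partitionD1 (mpp_partition p) pB1.
    have part2 : partition (blocks p :\: [set B1; B2]) (~: (B1 :|: B2)).
      rewrite -setDDl -setTD -setDDl; apply: partitionD1 part1 _.
      by rewrite !inE eq_sym B12.
    rewrite -(setUCr (B1 :|: B2)); apply: partitionU1 part2 _ _.
      by rewrite -card_gt0 (leq_trans _ (subset_leq_card sX)) // card_gt0.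
    by rewrite -setI_eq0 setICr.
  have Ept : pointed (Mpp r_mpp) = pt by [].
  exists (Mpp r_mpp).
    apply/exists_inP; exists B1 => //; apply/exists_inP; exists B2 => //.
    apply/and4P; split=> //=.
      have /eqP XU : X :\: (B1 :|: B2) == set0 by rewrite setD_eq0.
      by rewrite Ept /pt setDUl XU setU0 setDDl setUid.
    rewrite Ept X12 /X; case: ifP => [_|]; first by rewrite eqxx.
    have [_ E1] := pq B1 pB1; have [_ E2] := pq B2 pB2.
    by rewrite setIUl; case: E1 => ->; case: E2 => ->;
      rewrite ?set0U ?setU0 ?eqxx ?orbT.
  apply/mpp_belowP => C; rewrite Ept /blocks /= in_setU1 => /predU1P[->|].
    split; first by exists D; rewrite // subUset s1.
    by rewrite X12 /X; case: ifP => [/eqP|_]; auto.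
  rewrite in_setD => /andP[nC pC]; have [E1 E2] := pq C pC.
  by split=> //; rewrite ptC.
(* Without such a pair, a block of [p] inside a block of [q] fills it. *)
have sub C D : C \in blocks p -> D \in blocks q -> C \subset D -> C = D.
  move=> pC qD sCD; apply/eqP; rewrite eqEsubset sCD; apply/subsetP => z zD.
  have [C' pC' zC'] := mpp_blockP p z.
  have [[D' qD' sC'] _] := pq C' pC'.
  have DD' : D' = D := mpp_block_eq qD' qD (subsetP sC' z zC') zD.
  have /= := none (C, C'); rewrite pC pC' /= => /negbT; rewrite negb_and negbK.
  case/orP => [/eqP->//|/exists_inP[]]; exists D => //.
  by rewrite sCD -DD' sC'.
case/eqP: npq; have eqb : blocks p = blocks q.
  apply/setP => C; apply/idP/idP => [pC|qC].
    have [[D qD sCD] _] := pq C pC.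
    by rewrite (sub C D pC qD sCD).
  have [z zC] := set0Pn _ (mpp_block_neq0 qC).
  have [C' pC' zC'] := mpp_blockP p z.
  have [[D' qD' sC'] _] := pq C' pC'.
  by rewrite -(mpp_block_eq qD' qC (subsetP sC' z zC') zC) -(sub _ _ pC' qD' sC').
apply: mpp_ext => //; apply/setP => z.
have [C pC zC] := mpp_blockP p z; have [_ []] := pq C pC.
  by move/eqP/negPf; rewrite eqb in pC; rewrite (negPf (mpp_pointed pC)).
by move/setP/(_ z); rewrite !inE zC /=.
Qed.

Lemma mpp_le_below p q : (p <= q)%O = mpp_below p q.
Proof.
rewrite mpp_leE; apply/idP/idP => [|].
  case/connectP => s; elim: s p => [|r s IHs] p /=.
    move=> _ ->; apply/mpp_belowP => C pC; split; last by right.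
    by exists C.
  case/andP => /mpp_merge_below pr rs qE.
  exact: mpp_below_trans pr (IHs r rs qE).
have [m] := ubnP #|blocks p|; elim: m => // m IHm in p *.
rewrite ltnS => le_pm pq; have [->|npq] := eqVneq p q; first exact: connect0.
have [r pr rq] := mpp_below_merge pq npq.
apply: connect_trans (connect1 pr) (IHm r _ rq).
exact: leq_trans (mpp_merge_card pr) le_pm.
Qed.

(** * Least element, chains and rank *)

Lemma card_blocks_mpp0 : #|blocks (mpp0 n)| = n.
Proof. by rewrite /blocks /= card_imset ?card_ord //; apply: set1_inj. Qed.

Lemma mpp0_le p : (mpp0 n <= p)%O.
Proof.
rewrite mpp_le_below; apply/mpp_belowP => _ /imsetP[x _ ->].
have [B pB xB] := mpp_blockP p x; split; first by exists B; rewrite ?sub1set.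
have [xp|nxp] := boolP (x \in pointed p); [right | left].
  by rewrite setIT; apply/setIidPl; rewrite sub1set.
by apply/eqP; rewrite setI_eq0 disjoints1.
Qed.

Lemma card_blocks_le p : (#|blocks p| <= n)%N.
Proof.
have /mpp_le_card[<-|] : mpp_le (mpp0 n) p := mpp0_le p.
  by rewrite card_blocks_mpp0.
by rewrite card_blocks_mpp0 => /ltnW.
Qed.

Lemma mpp_lt_card p q : (p < q)%O -> (#|blocks q| < #|blocks p|)%N.
Proof.
rewrite lt_neqAle => /andP[npq]; rewrite mpp_leE => /mpp_le_card[] // E.
by rewrite E eqxx in npq.
Qed.

Lemma mpp_le_card_le p q : (p <= q)%O -> (#|blocks q| <= #|blocks p|)%N.
Proof. by rewrite mpp_leE => /mpp_le_card[->|/ltnW]. Qed.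

Lemma mpp_merge_cardE p q : mpp_merge p q -> #|blocks p| = #|blocks q|.+1.
Proof.
case/exists_inP => B1 pB1 /exists_inP[B2 pB2 /and4P[B12 /eqP-> _ _]].
have sub12 : [set B1; B2] \subset blocks p.
  by apply/subsetP => B; rewrite !inE => /orP[] /eqP->.
rewrite -(cardsID [set B1; B2] (blocks p)) (setIidPr sub12) cards2 B12 cardsU1.
rewrite in_setD negb_and negbK; case: (boolP (B1 :|: B2 \in blocks p)) => [pU|_].
  have [x xB] := set0Pn _ (mpp_block_neq0 pB1).
  have xU : x \in B1 :|: B2 by rewrite inE xB.
  by rewrite -(mpp_block_eq pB1 pU xB xU) set21.
by rewrite orbT.
Qed.

(** Each merge on a path from [mpp0 n] to [p] adds one element to the chain and removes one
    block. *)
Lemma maximal_chain p : exists C : {set mpp n},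
  [/\ is_chain C, [forall c in C, (c <= p)%O] & (#|C| + #|blocks p| = n.+1)%N].
Proof.
have /connectP[s] : mpp_le (mpp0 n) p := mpp0_le p.
elim/last_ind: s p => [|s q IHs] p /=.
  move=> _ ->; exists [set mpp0 n]; rewrite cards1 card_blocks_mpp0; split=> //.
    apply/forall_inP => x /set1P->; apply/forall_inP => y /set1P->.
    by rewrite comparablexx.
  by apply/forall_inP => x /set1P->.
rewrite rcons_path last_rcons => /andP[ps sq ->] {p}.
have [C [chC /forall_inP leC cardC]] := IHs _ ps erefl.
set r := last _ s in sq leC cardC.
have lt_rq : (r < q)%O.
  have le_rq : (r <= q)%O := connect1 sq.
  rewrite lt_neqAle le_rq andbT.
  by apply: contraTneq sq => <-; apply/negP => /mpp_merge_card; rewrite ltnn.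
exists (q |: C); split.
- apply/forall_inP => x /setU1P[->|Cx]; apply/forall_inP => y /setU1P[->|Cy].
  + exact: comparablexx.
  + by apply/ge_comparable/(le_trans (leC y Cy))/ltW.
  + by apply/le_comparable/(le_trans (leC x Cx))/ltW.
  + by have /forall_inP/(_ x Cx)/forall_inP := chC; apply.
- by apply/forall_inP => x /setU1P[->//|/leC/le_trans]; apply; apply: ltW.
- have nqC : q \notin C by apply: contraTN lt_rq => /leC/le_gtF->.
  by rewrite cardsU1 nqC -cardC (mpp_merge_cardE sq) addnS.
Qed.

Definition down_closed A := forall p q, q \in A -> (p <= q)%O -> p \in A.

(** The number of blocks decreases strictly along a chain, which bounds its length; [maximal_chain]
    attains the bound and stays in [A] as [A] is down-closed. *)
Lemma rank_in_mpp A a : down_closed A -> a \in A ->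
  rank_in A a = (n - #|blocks a|)%N.
Proof.
move=> dA Aa; apply/eqP; rewrite eqn_leq; apply/andP; split.
  apply/bigmax_leqP => C /and3P[_ /forall_inP chC /forall_inP leC].
  set r := (n - #|blocks a|)%N.
  pose f (c : mpp n) : 'I_r.+1 := inord (n - #|blocks c|).
  have inj : {in C &, injective f}.
    move=> x y Cx Cy /(congr1 val); rewrite /= !inordK; last 2 first.
    + by rewrite ltnS leq_sub2l // mpp_le_card_le ?leC.
    + by rewrite ltnS leq_sub2l // mpp_le_card_le ?leC.
    move=> E; have := card_blocks_le x; have := card_blocks_le y.
    have /forall_inP/(_ y Cy) := chC x Cx.
    by case: comparableP => // /mpp_lt_card; lia.
  have : (#|C| <= r.+1)%N.
    by rewrite -(card_in_imset inj) (leq_trans (max_card _)) ?card_ord.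
  by case: #|C|.
have [C [chC leC cardC]] := maximal_chain a.
have -> : (n - #|blocks a|)%N = #|C|.-1 by lia.
rewrite /rank_in; apply: (@leq_bigmax_cond _ _ (fun C : {set mpp n} => #|C|.-1)).
rewrite chC leC !andbT; apply/subsetP => c Cc.
by apply: dA Aa _; have /forall_inP := leC; apply.
Qed.

End Mpp.

(** * Moebius function and characteristic polynomials *)

Definition mpp_weight (n : nat) (p : mpp n) : int :=
  \prod_(B in blocks p) block_coef 1 #|B :\: pointed p| #|B :&: pointed p|.

Definition mpp_monomial (n : nat) (p : mpp n) : {poly int} :=
  \prod_(B in blocks p)
    ('X * (block_coef 1 #|B :\: pointed p| #|B :&: pointed p|)%:P).

Lemma mpp_monomialE n (p : mpp n) :
  mpp_monomial p = 'X^#|blocks p| * (mpp_weight p)%:P.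
Proof. by rewrite /mpp_monomial big_split prodr_const -rmorph_prod. Qed.

(** Weights and conditions are local to the blocks, so [prod_block_sum] lets the pointed subsets be
    chosen block by block. *)
Lemma sum_mpp (R : comNzRingType) n (kappa : {set 'I_n} -> {set 'I_n} -> bool)
    (g : {set 'I_n} -> {set 'I_n} -> R) :
  \sum_(p : mpp n | [forall B in blocks p, kappa B (B :&: pointed p)])
    \prod_(B in blocks p) g B (B :&: pointed p) =
  partition_sum (fun B => \sum_(S : {set 'I_n} |
    (S \subset B) && ((S != set0) && kappa B S)) g B S) [set: 'I_n].
Proof.
pose g' B S := if (S != set0) && kappa B S then g B S else 0.
transitivity (\sum_(P : {set {set 'I_n}} | partition P [set: 'I_n])
    \sum_(S : {set 'I_n} | S \subset [set: 'I_n]) \prod_(B in P) g' B (B :&: S));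
  last first.
  apply: eq_bigr => P partP; rewrite -(prod_block_sum _ partP).
  by apply: eq_bigr => B _; rewrite big_mkcondr.
rewrite pair_big_dep /=.
rewrite (bigID (fun t : {set {set 'I_n}} * {set 'I_n} =>
  [forall B in t.1, (B :&: t.2 != set0) && kappa B (B :&: t.2)])) /=.
rewrite [X in _ = _ + X]big1 ?addr0; last first.
  move=> [P S] /= /andP[_]; rewrite negb_forall_in => /exists_inP[B PB nB].
  by rewrite (bigD1 B) //= /g' (negPf nB) mul0r.
rewrite [RHS](reindex_onto (fun p : mpp n => val p) (insubd (mpp0 n))) /=; last first.
  move=> [P S] /= /andP[/andP[partP _] /forall_inP all].
  rewrite insubdK // unfold_in /is_mpp /= partP /=.
  by apply/forall_inP => B /all /andP[].
apply: eq_big => [p|p /forall_inP all].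
  rewrite valKd eqxx andbT subsetT (mpp_partition p) /=.
  apply/forall_inP/forall_inP => H B pB; last by case/andP: (H B pB).
  by rewrite (mpp_pointed pB) H.
apply: eq_bigr => B pB; rewrite /g' ifT //.
by rewrite (mpp_pointed pB) all.
Qed.

(** Passing from [c = 1] to [c = 2] absorbs the free choice of a pointed subset. The sign depends
    only on [#|B|], which leaves [block_weight_sum0] or [block_weight_sumS]. *)
Lemma sum_block_coef (T : finType) (V B : {set T}) :
    V \subset B -> B != set0 ->
  \sum_(S : {set T} | (S \subset B) && ((S != set0) && (V \subset S)))
    block_coef 1 #|B :\: S| #|S| = block_coef 2 #|B :\: V| #|V|.
Proof.
move=> sVB Bn0.
have cardB (S : {set T}) : S \subset B -> (#|B :\: S| + #|S| = #|B|)%N.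
  by move=> sSB; rewrite -(cardsID S B) (setIidPr sSB) addnC.
rewrite /block_coef cardB //.
transitivity ((-1) ^+ #|B|.-1 *
  \sum_(S : {set T} | (S \subset B) && ((S != set0) && (V \subset S)))
    (block_weight 1 #|B :\: S| #|S|)%:R : int).
  by rewrite big_distrr; apply: eq_bigr => S /andP[sSB _]; rewrite cardB.
congr (_ * _); rewrite big_mkcondr /=.
have [V0|[v vV]] := set_0Vmem V.
  rewrite V0 setD0 cards0.
  (* The value 0 at 0 discards the empty pointed subset. *)
  pose phi k : int := if k is _.+1 then (block_weight 1 (#|B| - k) k)%:R else 0.
  transitivity (\sum_(S : {set T} | S \subset B) phi #|S|).
    apply: eq_bigr => S sSB; rewrite sub0set andbT -card_gt0 /phi -(cardB S sSB) addnK.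
    by case: #|S|.
  rewrite sum_subset_card big_ord_recl mulr0 add0r /phi.
  rewrite -block_weight_sum0 ?card_gt0 // natr_sum.
  by apply: eq_bigr => k _; rewrite natrM.
(* With [S] split along [V], only the part [S1 = V] contributes. *)
rewrite (sum_subset_split _ sVB) (bigD1 V) //= [X in _ + X]big1 ?addr0; last first.
  move=> S1 /andP[sS1 nS1]; apply: big1 => S2; rewrite subsetD => /andP[_ dS2].
  rewrite [_ && (V \subset _)]andbC ifF //; apply/negbTE; apply: contra nS1.
  case/andP=> sV _; rewrite eqEsubset sS1; apply/subsetP => z zV.
  have /setUP[//|zS2] := subsetP sV z zV.
  by rewrite (disjointFr dS2 zS2) in zV.
have Vt : #|V| = #|V|.-1.+1 by rewrite prednK // card_gt0; apply/set0Pn; exists v.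
pose phi l : int := (block_weight 1 (#|B :\: V| - l) (#|V|.-1.+1 + l))%:R.
transitivity (\sum_(S : {set T} | S \subset B :\: V) phi #|S|).
  apply: eq_bigr => S; rewrite subsetD => /andP[sSB dSV].
  have SV : S :&: V = set0 by apply/eqP; rewrite setI_eq0.
  have SUV : #|V :|: S| = (#|V| + #|S|)%N by rewrite cardsU setIC SV cards0 subn0.
  rewrite subsetUl andbT ifT; last by apply/set0Pn; exists v; rewrite inE vV.
  rewrite /phi -Vt SUV -setDDl; congr (block_weight _ _ _)%:R.
  by rewrite cardsD (setIidPr _) // subsetD sSB.
rewrite sum_subset_card /phi [in RHS]Vt -block_weight_sumS natr_sum.
by apply: eq_bigr => l _; rewrite natrM.
Qed.

(** Below [a], each block lies in a block of [a]; its trace on [pointed a] is its pointed subset if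
    non-empty, and otherwise the choice is free. In both cases the terms of a block [B] add up to
    [h B]. *)
Lemma sum_mpp_below n (a : mpp n) :
  \sum_(z : mpp n | (z <= a)%O) mpp_monomial z =
  \prod_(D in blocks a) set_poly 1 #|D :\: pointed a| #|D :&: pointed a|.
Proof.
pose kappa (B S : {set 'I_n}) := [exists D in blocks a, B \subset D] &&
  ((B :&: pointed a == set0) || (B :&: pointed a == S)).
pose g (B S : {set 'I_n}) : {poly int} := 'X * (block_coef 1 #|B :\: S| #|S|)%:P.
transitivity (\sum_(z : mpp n | [forall B in blocks z, kappa B (B :&: pointed z)])
    \prod_(B in blocks z) g B (B :&: pointed z)).
  apply: eq_big => [z|z _]; first by rewrite mpp_le_below.
  by apply: eq_bigr => B _; rewrite /g setDIr setDv set0U.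
rewrite sum_mpp.
pose h (B : {set 'I_n}) : {poly int} :=
  'X * (block_coef 1 #|B :\: pointed a| #|B :&: pointed a|)%:P.
rewrite (@eq_partition_sum _ _ _
    (fun B => if [exists D in blocks a, B \subset D] then h B else 0)); last first.
  move=> B Bn0; rewrite /kappa; case: ifP => _; last first.
    by rewrite big_pred0 // => S; rewrite /= !andbF.
  have [B0|nB0] := eqVneq (B :&: pointed a) set0.
    have BD : B :\: pointed a = B by apply/setDidPl; rewrite -setI_eq0 B0.
    (* With no forced element the weight does not depend on [c], so the sum over all pointed
       subsets, given with [c = 2], is the required coefficient with [c = 1]. *)
    rewrite /h B0 BD cards0 -[block_coef 1 #|B| 0]/(block_coef 2 #|B| 0).
    have := sum_block_coef (sub0set B) Bn0; rewrite setD0 cards0 => <-.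
    rewrite rmorph_sum big_distrr; apply: eq_bigl => S.
    by rewrite sub0set.
  rewrite (big_pred1 (B :&: pointed a)) /g ?setDIr ?setDv ?set0U // => S /=.
  rewrite [B :&: _ == S]eq_sym; case: (S =P B :&: pointed a) => [->|_].
    by rewrite subsetIl nB0.
  by rewrite !andbF.
rewrite (@partition_sum_refine _ _ h
  (fun U => set_poly 1 #|U :\: pointed a| #|U :&: pointed a|)) //.
- by apply: eq_bigr => D _; rewrite setIT.
- exact: mpp_partition.
- by rewrite set0D set0I cards0 set_poly00.
- by move=> U; apply: set_poly_rec.
Qed.

Lemma partition_setT_ord n :
  (0 < n)%N -> partition [set [set: 'I_n]] [set: 'I_n].
Proof.
move=> n0; apply/and3P; split; first by rewrite /cover big_set1.
  by apply/trivIsetP => B C /set1P-> /set1P->; rewrite eqxx.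
by rewrite inE eq_sym; apply/set0Pn; exists (Ordinal n0); rewrite inE.
Qed.

Lemma sum_mpp_above n (V : {set 'I_n}) : (0 < n)%N ->
  \sum_(z : mpp n | V \subset pointed z) mpp_monomial z =
  set_poly 2 (n - #|V|) #|V|.
Proof.
move=> n0.
pose kappa (B S : {set 'I_n}) := B :&: V \subset S.
pose g (B S : {set 'I_n}) : {poly int} := 'X * (block_coef 1 #|B :\: S| #|S|)%:P.
transitivity (\sum_(z : mpp n | [forall B in blocks z, kappa B (B :&: pointed z)])
    \prod_(B in blocks z) g B (B :&: pointed z)).
  apply: eq_big => [z|z _]; last first.
    by apply: eq_bigr => B _; rewrite /g setDIr setDv set0U.
  apply/idP/forall_inP => [sV B zB|H]; first exact: setIS.
  apply/subsetP => x xV; have [B zB xB] := mpp_blockP z x.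
  by have /subsetP/(_ x) := H B zB; rewrite !inE xB; apply.
rewrite sum_mpp.
pose h (B : {set 'I_n}) : {poly int} := 'X * (block_coef 2 #|B :\: V| #|B :&: V|)%:P.
(* The one-block partition makes the refinement condition vacuous. *)
rewrite (@eq_partition_sum _ _ _
    (fun B => if [exists D in [set [set: 'I_n]], B \subset D] then h B else 0));
  last first.
  move=> B Bn0; rewrite ifT; last first.
    by apply/exists_inP; exists [set: 'I_n]; rewrite ?inE.
  have := sum_block_coef (subsetIl B V) Bn0.
  by rewrite /h setDIr setDv set0U => <-; rewrite rmorph_sum big_distrr.
rewrite (@partition_sum_refine _ _ h
  (fun U => set_poly 2 #|U :\: V| #|U :&: V|)).
- by rewrite big_set1 setIT setTI setTD cardsCs setCK card_ord.
- exact: partition_setT_ord.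
- by rewrite set0D set0I cards0 set_poly00.
- by move=> U; apply: set_poly_rec.
Qed.

(** The root comes from the first product if [i > 1], and from the factor ['X] minus [c * i] with
    [c = 1] if [i = 1]. *)
Lemma set_poly_root1 a i : (0 < i)%N -> (1 < a + i)%N ->
  (set_poly 1 a i).[1] = 0.
Proof.
case: i => [//|[|i]] _; rewrite /set_poly hornerM; last first.
  by rewrite !big_ord_recl !hornerM !hornerXsubC subrr !(mul0r, mulr0).
by case: a => [//|a] _; rewrite !hornerM !hornerXsubC subrr mul0r mulr0.
Qed.

(** At x = 1 the product of [sum_mpp_below] vanishes, since [a] has a block with at least two
    elements. *)
Lemma sum_mpp_weight_eq0 n (a : mpp n) : mpp0 n != a ->
  \sum_(z : mpp n | (z <= a)%O) mpp_weight z = 0.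
Proof.
move=> na0; have := congr1 (horner^~ 1) (sum_mpp_below a).
rewrite /= horner_sum horner_prod => E.
transitivity (\sum_(z : mpp n | (z <= a)%O) (mpp_monomial z).[1]).
  apply: eq_bigr => z _.
  by rewrite mpp_monomialE hornerM hornerXn expr1n mul1r hornerC.
have [D aD D1] : exists2 D, D \in blocks a & (1 < #|D|)%N.
  apply/exists_inP; apply: contraNT na0 => /exists_inPn noD.
  have /mpp_le_card[->//|] : mpp_le (mpp0 n) a := mpp0_le a.
  rewrite card_blocks_mpp0 ltnNge => /negP[].
  rewrite -[X in (X <= _)%N]card_ord -cardsT (card_partition (mpp_partition a)).
  by rewrite -sum1_card leq_sum // => D /noD; rewrite -leqNgt.
rewrite E (bigD1 D aD) /= set_poly_root1 ?mul0r //.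
  by rewrite card_gt0 mpp_pointed.
by rewrite addnC cardsID.
Qed.

Lemma mobius_mpp n (A : {set mpp n}) (a : mpp n) :
  down_closed A -> a \in A -> mobius A (mpp0 n) a = mpp_weight a.
Proof.
move=> dA; have [m] := ubnP (n - #|blocks a|).
elim: m => // m IHm in a *; rewrite ltnS => le_am Aa; rewrite mobiusE.
case: eqVneq => [<-|na0].
  rewrite /mpp_weight big1 // => _ /imsetP[x _ ->].
  by rewrite setDT setIT cards0 cards1 /block_coef /= !mul1n.
apply/eqP; rewrite eqr_oppLR -addr_eq0 addrC.
apply/eqP; rewrite -[RHS](sum_mpp_weight_eq0 na0) [RHS](bigD1 a) //=.
congr (_ + _); apply: eq_big => [z|z /and3P[Az _ lt_za]].
  rewrite mpp0_le /= lt_neqAle andbC; case: (z != a); rewrite ?andbF //=.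
  by rewrite andbT; apply/andP/idP => [[]//|le_za]; split=> //; apply: dA Aa le_za.
apply: IHm Az; apply: leq_trans le_am.
by have := mpp_lt_card lt_za; have := card_blocks_le z; lia.
Qed.

(** The one-block element [p1] gives [A] rank n - 1; the factor ['X] raises the exponent of each
    term to its number of blocks. *)
Lemma charpoly_mpp n (A : {set mpp n}) (p1 : mpp n) :
    (0 < n)%N -> down_closed A -> p1 \in A -> #|blocks p1| = 1%N ->
  'X * charpoly A (mpp0 n) = \sum_(a in A) mpp_monomial a.
Proof.
move=> n0 dA Ap1 p1E.
have b0 (a : mpp n) : (0 < #|blocks a|)%N.
  have [B aB _] := mpp_blockP a (Ordinal n0).
  by rewrite card_gt0; apply/set0Pn; exists B.
have rkE : poset_rank A = n.-1.
  apply/eqP; rewrite eqn_leq; apply/andP; split.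
    by apply/bigmax_leqP => a Aa; rewrite rank_in_mpp // -subn1 leq_sub2l.
  rewrite -subn1 -p1E -(rank_in_mpp dA Ap1).
  exact: (@leq_bigmax_cond _ _ (fun a : mpp n => rank_in A a)).
rewrite /charpoly big_distrr /=; apply: eq_bigr => a Aa.
rewrite mobius_mpp // rank_in_mpp // rkE mpp_monomialE -mul_polyC mulrCA mulrC.
rewrite -exprS; congr ('X^_ * _).
by have := b0 a; have := card_blocks_le a; lia.
Qed.

Lemma charpoly_interval n (p : mpp n) :
    (0 < n)%N -> #|blocks p| = 1%N ->
  'X * charpoly [set q : mpp n | (mpp0 n <= q)%O && (q <= p)%O] (mpp0 n) =
  set_poly 1 (n - #|pointed p|) #|pointed p|.
Proof.
move=> n0 p1; rewrite (@charpoly_mpp _ _ p) //; first last.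
- by rewrite inE mpp0_le lexx.
- by move=> q r; rewrite !inE !mpp0_le => rp /le_trans; apply.
rewrite (eq_bigl (fun q => (q <= p)%O)); last by move=> q; rewrite inE mpp0_le.
rewrite sum_mpp_below; have /cards1P[D pD] : #|blocks p| == 1%N by apply/eqP.
have DT : D = [set: 'I_n].
  by rewrite -(cover_partition (mpp_partition p)) pD /cover big_set1.
by rewrite pD big_set1 DT setTI setTD cardsCs setCK card_ord.
Qed.

Lemma charpoly_MPiA n i : (0 < n)%N -> (i <= n)%N ->
  'X * charpoly (MPiA n i) (mpp0 n) = set_poly 2 (n - i) i.
Proof.
move=> n0 le_in.
have top_mpp : is_mpp ([set [set: 'I_n]], [set: 'I_n]).
  rewrite /is_mpp /= partition_setT_ord //.
  apply/forall_inP => B /set1P->; rewrite setIT.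
  by apply/set0Pn; exists (Ordinal n0); rewrite inE.
rewrite (@charpoly_mpp _ _ (Mpp top_mpp)) //; first last.
- by rewrite /blocks /= cards1.
- by rewrite inE subsetT.
(* An element pointed in [q] is pointed in every [p] below [q]. *)
- move=> p q; rewrite !inE => sV le_pq; apply: subset_trans sV _.
  apply/subsetP => x xq; have [C pC xC] := mpp_blockP p x.
  move: le_pq; rewrite mpp_le_below => /mpp_belowP/(_ C pC)[_ []].
    by move/setP/(_ x); rewrite !inE xC xq.
  by move/setP/(_ x); rewrite !inE xC xq /= => <-.
pose V := [set j : 'I_n | (j < i)%N].
have cardV : #|V| = i.
  have winj : injective (widen_ord le_in).
    by move=> j k /(congr1 val) /= jk; apply: val_inj.
  rewrite -[RHS]card_ord -(card_imset _ winj).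
  apply: eq_card => j; rewrite inE; apply/idP/imsetP => [lt_ji|[k _ ->]] //=.
  by exists (Ordinal lt_ji) => //; apply: val_inj.
rewrite -cardV -sum_mpp_above // cardV.
by apply: eq_bigl => p; rewrite inE.
Qed.

(** * Closed formulas in terms of [angle] *)

Lemma horner_angle_neg k m :
  (angle k).[- m.+1%:R] = (-1) ^+ k * (rising m.+2 k)%:R.
Proof.
rewrite /angle big_add1 big_mkord /= (horner_prod_neg _ succn).
by congr (_ * _%:R); apply: eq_bigr => j _; rewrite addnS.
Qed.

Lemma set_weight_rising c m a i :
  (set_weight c m.+1 a i * ((m.+1 + c * i + a)`! * m`!) =
   (m + i)`! * (m.+1 + c * i) * (m + c * i + 2 * a)`!)%N.
Proof.
rewrite /set_weight -(rising_fact m i) !addSn.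
have := ballot_fact a (m + c * i); rewrite addSn => B.
rewrite -mulnA -[in RHS]mulnA -B.
move: (ballot _ _) (rising _ _) (_)`! a`! m`! => ? ? ? ? ?; ring.
Qed.

(** Values at negative integers are compared through [set_weight_rising]; for c = 1 its factor m + 1
    + i completes (m + i)! to (m + 1 + i)!. *)
Lemma set_poly1_angle a i : (0 < a + i)%N ->
  set_poly 1 a i * angle (a + i) = 'X * (angle i * angle (2 * a + i).-1).
Proof.
move=> ai0; apply: poly_eq_neg_nat => m.
rewrite [LHS]hornerM horner_set_poly !hornerM !horner_angle_neg hornerX.
set k := (2 * a + i).-1.
have E : (set_weight 1 m.+1 a i * rising m.+2 (a + i) =
    m.+1 * rising m.+2 i * rising m.+2 k)%N.
  have F0 : (0 < m.+1`! * m`!)%N by rewrite muln_gt0 !fact_gt0.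
  apply/eqP; rewrite -(eqn_pmul2r F0); apply/eqP.
  transitivity (set_weight 1 m.+1 a i * ((m.+1 + 1 * i + a)`! * m`!))%N.
    rewrite mul1n -addnA (addnC i) -(rising_fact m.+1 (a + i)).
    move: (rising _ _) (set_weight _ _ _ _) m.+1`! m`! => ? ? ? ?; ring.
  rewrite set_weight_rising mul1n.
  have -> : (m + i + 2 * a = m.+1 + k)%N by rewrite /k; lia.
  rewrite -(rising_fact m.+1 k).
  have -> : ((m + i)`! * (m.+1 + i) = (m.+1 + i)`!)%N by rewrite addSn factS mulnC.
  rewrite -(rising_fact m.+1 i) (factS m).
  move: (rising _ _) (rising _ _) m`! => ? ? ?; ring.
have sgn : (-1) ^+ (a + i) * (-1) ^+ (a + i) = - ((-1) ^+ i * (-1) ^+ k) :> int.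
  rewrite -[RHS]mulrN1 -!exprD -exprSr; congr (_ ^+ _); rewrite /k; lia.
rewrite mulrACA sgn -natrM E !natrM; ring.
Qed.

(** For c = 2 the factor m + 1 + 2i does not complete (m + i)!: it survives as x - 2i, and the
    multiplier x - i supplies the missing factor. *)
Lemma set_poly2_angle a i : (0 < a + i)%N ->
  set_poly 2 a i * ('X - (i%:R)%:P) * angle (a + 2 * i) =
  'X * ('X - ((2 * i)%N%:R)%:P) * (angle i * angle (2 * (a + i)).-1).
Proof.
move=> ai0; apply: poly_eq_neg_nat => m.
rewrite [LHS]hornerM [in LHS]hornerM horner_set_poly !hornerM !horner_angle_neg.
rewrite hornerX !hornerXsubC.
set k := (2 * (a + i)).-1.
have E : (set_weight 2 m.+1 a i * (m.+1 + i) * rising m.+2 (a + 2 * i) =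
    m.+1 * (m.+1 + 2 * i) * rising m.+2 i * rising m.+2 k)%N.
  have F0 : (0 < m.+1`! * m`!)%N by rewrite muln_gt0 !fact_gt0.
  apply/eqP; rewrite -(eqn_pmul2r F0); apply/eqP.
  transitivity (set_weight 2 m.+1 a i * ((m.+1 + 2 * i + a)`! * m`!) * (m.+1 + i))%N.
    rewrite -addnA (addnC (2 * i)%N) -(rising_fact m.+1 (a + 2 * i)).
    move: (rising _ _) (set_weight _ _ _ _) m.+1`! m`! => ? ? ? ?; ring.
  rewrite set_weight_rising.
  have -> : (m + 2 * i + 2 * a = m.+1 + k)%N by rewrite /k; lia.
  rewrite -(rising_fact m.+1 k).
  transitivity ((m + i)`! * (m.+1 + i) * ((m.+1 + 2 * i) * (rising m.+2 k * m.+1`!)))%N.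
    move: (rising _ _) (m + i)`! m.+1`! => ? ? ?; ring.
  have -> : ((m + i)`! * (m.+1 + i) = (m.+1 + i)`!)%N by rewrite addSn factS mulnC.
  rewrite -(rising_fact m.+1 i) (factS m).
  move: (rising _ _) (rising _ _) m`! => ? ? ?; ring.
have sgn : (-1) ^+ (a + i) * (-1) ^+ (a + 2 * i) = - ((-1) ^+ i * (-1) ^+ k) :> int.
  rewrite -[RHS]mulrN1 -!exprD -exprSr -signr_odd -[RHS]signr_odd.
  by congr (_ ^+ nat_of_bool _); rewrite /k; lia.
have {}E := congr1 (fun x : nat => x%:R : int) E.
transitivity (- ((-1) ^+ (a + i) * (-1) ^+ (a + 2 * i)) *
  (set_weight 2 m.+1 a i * (m.+1 + i) * rising m.+2 (a + 2 * i))%N%:R : int).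
  rewrite !natrM natrD; ring.
rewrite sgn E !natrM natrD; ring.
Qed.

Lemma angle_neq0 k : angle k != 0.
Proof. by rewrite /angle prodf_seq_neq0; apply/allP => j _; rewrite polyXsubC_eq0. Qed.

Lemma angle0 k : (angle k)`_0 = (-1) ^+ k * (k`!)%:R.
Proof.
elim: k => [|k IHk]; first by rewrite /angle big_nil coefC mul1r.
rewrite -!horner_coef0 /angle big_nat_recr //= hornerM hornerXsubC.
rewrite horner_coef0 -/(angle k) IHk factS natrM exprS; ring.
Qed.

Lemma tofrac_div (p q r : {poly int}) : r != 0 -> p * r = q ->
  tofrac p = tofrac q / tofrac r.
Proof.
by move=> r0 <-; rewrite tofracM mulfK // tofrac_eq0.
Qed.

Lemma charpoly_MPiA'_angle n (i : nat) (A : {set mpp n}) :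
  (0 < n)%N -> (i <= n)%N -> is_MPiA' i A ->
  charpoly A (mpp0 n) * angle n = angle i * angle (2 * n - i - 1).
Proof.
move=> n0 le_in HA; apply: (mulfI (negbT (polyX_eq0 int))); rewrite mulrA.
have -> : 'X * charpoly A (mpp0 n) = set_poly 1 (n - i) i.
  (* For [i = 0] the whole poset is [MPiA n 0], and [set_poly c n 0] does not depend on [c]. *)
  case: i le_in HA => [|i] le_in.
    move=> ->; have -> : [set: mpp n] = MPiA n 0.
      apply/setP => p; rewrite !inE; apply/esym/subsetP => j; by rewrite inE.
    by rewrite charpoly_MPiA // /set_poly muln0.
  by case=> p [p1 pi ->]; rewrite charpoly_interval // pi.
rewrite -{2}(subnK le_in) set_poly1_angle; last by lia.
by congr (_ * (_ * angle _)); lia.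
Qed.

Lemma charpoly_MPiA_angle n i : (0 < n)%N -> (i <= n)%N ->
  charpoly (MPiA n i) (mpp0 n) * (('X - (i%:R)%:P) * angle (n + i)) =
  ('X - ((2 * i)%N%:R)%:P) * (angle i * angle (2 * n - 1)).
Proof.
move=> n0 le_in; apply: (mulfI (negbT (polyX_eq0 int))).
rewrite !mulrA charpoly_MPiA //.
have -> : (n + i = (n - i) + 2 * i)%N by lia.
rewrite set_poly2_angle; last by lia.
by rewrite subnK // subn1 !mulrA.
Qed.

Theorem theorem2p2 (n : nat) (hn : (1 <= n)%N) :
  (forall i : nat, (1 <= i <= n)%N ->
     let chi := charpoly (MPiA n i) (mpp0 n) in
     chi%:F = ('X - ((2 * i)%N%:R)%:P)%:F / ('X - (i%:R)%:P)%:F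
              * ((angle i)%:F * (angle (2 * n - 1))%:F / (angle (n + i))%:F)
     /\ (chi`_0)%:~R
        = (-1) ^+ (n - 1) * 2 * ((i`!)%:R * ((2 * n - 1)`!)%:R / ((n + i)`!)%:R)
        :> rat)
  /\
  (forall (i : nat) (A : {set mpp n}), (i <= n)%N -> is_MPiA' i A ->
     let chi := charpoly A (mpp0 n) in
     chi%:F = (angle i)%:F * (angle (2 * n - i - 1))%:F / (angle n)%:F
     /\ (chi`_0)%:~R
        = (-1) ^+ (n - 1) * ((i`!)%:R * ((2 * n - i - 1)`!)%:R / (n`!)%:R)
        :> rat).
Proof.
have fact_neq0 k : (k`!)%:R != 0 :> rat by rewrite pnatr_eq0 -lt0n fact_gt0.
have sign_neq0 k : (-1) ^+ k != 0 :> rat by rewrite signr_eq0.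
split=> [i /andP[i0 le_in] chi|i A le_in HA chi].
  have E := charpoly_MPiA_angle hn le_in; split.
    rewrite mulf_div -!tofracM; apply: tofrac_div => //.
    by rewrite mulf_neq0 ?polyXsubC_eq0 ?angle_neq0.
  (* The constant term is read off the identity without denominators, at 0 and in [rat]; the factor
     2 is the quotient of 2i by i. *)
  have := congr1 (fun p : {poly int} => (p.[0])%:~R : rat) E.
  rewrite /= !hornerM !hornerXsubC !horner_coef0 !angle0 -/chi.
  rewrite !(rmorphM, rmorphB, rmorph0, rmorphXn, rmorphN, rmorph1, rmorph_nat) /= => {}E.
  have i_neq0 : i%:R != 0 :> rat by rewrite pnatr_eq0 -lt0n.
  apply: (mulIf (mulf_neq0 i_neq0
    (mulf_neq0 (sign_neq0 (n + i)%N) (fact_neq0 (n + i)%N)))).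
  have sgn : (-1) ^+ (n - 1) * (-1) ^+ (n + i) = (-1) ^+ i * (-1) ^+ (2 * n - 1) :> rat.
    by rewrite -!exprD; congr (_ ^+ _); lia.
  transitivity (2 * i%:R * ((-1) ^+ i * (-1) ^+ (2 * n - 1)) *
      (i`!%:R * (2 * n - 1)`!%:R) : rat).
    move: E; rewrite natrM; move: (_ ^+ i) (_ ^+ (2 * n - 1)) (_ ^+ (n + i)).
    move: (_ `!%:R) (_ `!%:R) (_ `!%:R) => f1 f2 f3 s1 s2 s3 E.
    apply: oppr_inj; rewrite -mulrN -mulNr -[- i%:R]sub0r E; ring.
  rewrite -sgn; move: (fact_neq0 (n + i)%N) (_ ^+ (n - 1)) (_ ^+ (n + i)).
  by move: (_ `!%:R) (_ `!%:R) (_ `!%:R) => ? ? ? ? ? ?; field.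
have E := charpoly_MPiA'_angle hn le_in HA; split.
  by rewrite -tofracM; apply: tofrac_div; rewrite ?angle_neq0.
have := congr1 (fun p : {poly int} => (p.[0])%:~R : rat) E.
rewrite /= !hornerM !horner_coef0 !angle0 -/chi.
rewrite !(rmorphM, rmorphXn, rmorphN, rmorph1, rmorph_nat) /= => {}E.
apply: (mulIf (mulf_neq0 (sign_neq0 n) (fact_neq0 n))); rewrite E.
have sgn : (-1) ^+ i * (-1) ^+ (2 * n - i - 1) = (-1) ^+ (n - 1) * (-1) ^+ n :> rat.
  by rewrite -!exprD; congr (_ ^+ _); lia.
rewrite mulrACA sgn; move: (fact_neq0 n) (_ ^+ (n - 1)) (_ ^+ n).
by move: (_ `!%:R) (_ `!%:R) (_ `!%:R) => ? ? ? ? ? ?; field.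
Qed.
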